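(* Let $q=2h+3$ be odd with $h\ge1$, let $\lambda=2\cos(\pi/q)$, and let $$\mathcal{H}_q=\frac{1}{2\sqrt{\left(1-\frac{\lambda}{2}\right)^2+1}}.$$ For every $G_q$-irrational $x$ (in $[-\lambda/2,\lambda/2)$) there are infinitely many $n\in\mathbb{N}$ such that $$\Theta_n(x)\le\mathcal{H}_q.$$ The constant $\mathcal{H}_q$ is best possible, i.e. it cannot be replaced by any smaller constant in this statement.
   Context: Rosen continued fractions. For $x\in[-\lambda/2,\lambda/2)$, $x\neq 0$, let $\varepsilon(x)\in\{\pm1\}$ be the sign of $x$ and $r(x)=\left\lfloor \frac{1}{\lambda|x|}+\frac12\right\rfloor$. Define $f_q:[-\lambda/2,\lambda/2)\to[-\lambda/2,\lambda/2)$ by $f_q(x)=\frac{1}{|x|}-\lambda r(x)$ for $x\ne0$ and $f_q(0)=0$. Put $\varepsilon_n=\varepsilon(f_q^{n-1}(x))$ and $r_n=r(f_q^{n-1}(x))$ for $n\ge1$ as long as $f_q^{n-1}(x)\neq0$. This gives the Rosen expansion $$x=[\varepsilon_1:r_1,\varepsilon_2:r_2,\ldots]:=\cfrac{\varepsilon_1}{r_1\lambda+\cfrac{\varepsilon_2}{r_2\lambda+\cdots}}.$$ The number $x$ is $G_q$-rational if its Rosen expansion is finite (i.e. $f_q^m(x)=0$ for some $m\ge 0$), and $G_q$-irrational otherwise. Convergents: $R_n/S_n=[\varepsilon_1:r_1,\ldots,\varepsilon_n:r_n]$, with $R_{-1}=1$, $R_0=0$, $S_{-1}=0$, $S_0=1$,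 $R_n=r_n\lambda R_{n-1}+\varepsilon_nR_{n-2}$, $S_n=r_n\lambda S_{n-1}+\varepsilon_nS_{n-2}$. The approximation coefficients are $\Theta_n(x)=S_n^2\left|x-\frac{R_n}{S_n}\right|$, $n\ge0$. *)

(* Defs.v *)
From Stdlib Require Import Reals.
Open Scope R_scope.

Definition lambda (q : nat) : R := 2 * cos (PI / INR q).

Definition hurwitz (q : nat) : R :=
  1 / (2 * sqrt ((1 - lambda q / 2) ^ 2 + 1)).

Definition rosen_dom (q : nat) (x : R) : Prop :=
  - (lambda q / 2) <= x < lambda q / 2.

(* The value at 0 is a convention; digits are only meaningful at nonzero
   points. *)
Definition eps (x : R) : R := if Rlt_dec x 0 then -1 else 1.

(* Int_part is the floor function. *)
Definition digit (q : nat) (x : R) : Z :=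
  Int_part (1 / (lambda q * Rabs x) + 1 / 2).

(* Total on R; it maps rosen_dom q to itself when 0 < lambda q. *)
Definition rosen_map (q : nat) (x : R) : R :=
  if Req_dec_T x 0 then 0 else 1 / Rabs x - lambda q * IZR (digit q x).

Definition orbit (q : nat) (x : R) (n : nat) : R := Nat.iter n (rosen_map q) x.

Definition Gq_rational (q : nat) (x : R) : Prop :=
  exists m : nat, orbit q x m = 0.

Definition Gq_irrational (q : nat) (x : R) : Prop := ~ Gq_rational q x.

(* The sequence u_n (n >= -1) with given u_{-1}, u_0 and
   u_n = r_n lambda u_{n-1} + eps_n u_{n-2} for n >= 1, presented as the pair
   (u_{n-1}, u_n); the digits r_{m+1}, eps_{m+1} are those of orbit q x m. *)
Fixpoint rosen_rec (q : nat) (x um1 u0 : R) (n : nat) : R * R :=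
  match n with
  | O => (um1, u0)
  | S m =>
      let (a, b) := rosen_rec q x um1 u0 m in
      let y := orbit q x m in
      (b, IZR (digit q y) * lambda q * b + eps y * a)
  end.

Definition conv_num (q : nat) (x : R) (n : nat) : R :=
  snd (rosen_rec q x 1 0 n).

Definition conv_den (q : nat) (x : R) (n : nat) : R :=
  snd (rosen_rec q x 0 1 n).

Definition Theta (q : nat) (x : R) (n : nat) : R :=
  conv_den q x n ^ 2 * Rabs (x - conv_num q x n / conv_den q x n).

Definition infinitely_many (P : nat -> Prop) : Prop :=
  forall N : nat, exists n : nat, (N <= n)%nat /\ P n.

(* Main.v *)
Require Import Defs.
From Stdlib Require Import Reals.
From Stdlib Require Import Lra Lia ZArith Classical_Prop.
Open Scope R_scope.

(* Write t_n for the orbit of x and v_n = S_(n-1) / S_n.  Then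
   Theta_n = 1 / (1 / |t_n| + eps_(n+1) v_n) = 1 / (t_(n+1) + 1 / v_(n+1)), and
   1 / H_q = rho + 1 / rho where rho^2 + (2 - lambda) rho = 1.  The pairs
   (t_n, v_n) stay in an explicit union of rectangles.

   Suppose Theta_n > H_q from some point on.  Then t_n < 0 from there on, since
   t_n > 0 would give t_n + 1 / t_n < rho + 1 / rho with t_n < rho < 1.  At an index
   with digit at least 2 the bounds on v_n force the digit to be 2 and - t_(n+1) to
   lie slightly above a point of the cycle of P = lambda - rho, whose digits are
   1^h, 2, 1^(h-1), 2 with all signs -1.  From then on the orbit of x follows this
   cycle, and its distance to it is multiplied by at least 2 / lambda > 1 at each
   step, which is impossible.  Conversely, x = - P is extremal: v_n converges to the
   purely periodic value read backwards, for which Theta_n is at least H_q. *)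

(** * The constants [lambda q], [rho q] and [hurwitz q] *)

Definition rho (q : nat) : R :=
  sqrt ((1 - lambda q / 2) ^ 2 + 1) - (1 - lambda q / 2).

(* For [q = 2 * h + 3], the points [- upper q k] with [k <= 2 * h + 1] are the orbit
   of [- (lambda q / 2)] under [rosen_map q], ending at [- upper q 0 = 0]. *)
Definition upper (q k : nat) : R :=
  sin (INR k * (PI / (2 * INR q))) / sin (INR (k + 2) * (PI / (2 * INR q))).

(* The points [- lower q k] with [k <= 2 * h] form the cycle of [rho q - lambda q]. *)
Fixpoint lower (q k : nat) : R :=
  match k with
  | O => / (rho q + 2)
  | S O => / (lambda q + rho q)
  | S (S j) => / (lambda q - lower q j)
  end.

Lemma lambda_bounds (q : nat) : (5 <= q)%nat -> 7 / 5 < lambda q < 2.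
Proof.
  intros hq; unfold lambda.
  assert (hq' : 5 <= INR q) by (replace 5 with (INR 5) by (simpl; lra); apply le_INR; lia).
  assert (hP := PI_RGT_0).
  assert (H0 : 0 < PI / INR q) by (apply Rdiv_lt_0_compat; lra).
  assert (H1 : PI / INR q < PI / 4).
  { apply Rmult_lt_compat_l; [lra|]. apply Rinv_lt_contravar; lra. }
  assert (H2 : cos (PI / INR q) < cos 0) by (apply cos_decreasing_1; lra).
  assert (H3 : cos (PI / 4) < cos (PI / INR q)) by (apply cos_decreasing_1; lra).
  rewrite cos_0 in H2; rewrite cos_PI4 in H3.
  assert (H4 : 7 / 10 < 1 / sqrt 2).
  { assert (Hs := sqrt_lt_R0 2 ltac:(lra)). assert (Hq := sqrt_sqrt 2 ltac:(lra)).
    apply (Rmult_lt_reg_r (sqrt 2)); [assumption|].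
    replace (1 / sqrt 2 * sqrt 2) with 1 by (field; lra). nra. }
  lra.
Qed.

(** [rho q] is the positive zero of X^2 + (2 - lambda) X - 1, a polynomial with value -(1 - lambda /
    2)^2 at lambda / 2 and 2 - lambda at 1. *)
Lemma rho_bounds (q : nat) : (5 <= q)%nat ->
  rho q ^ 2 + (2 - lambda q) * rho q = 1 /\ lambda q / 2 < rho q < 1.
Proof.
  intros hq; pose proof (lambda_bounds q hq) as hl.
  assert (Hs : sqrt ((1 - lambda q / 2) ^ 2 + 1) ^ 2 = (1 - lambda q / 2) ^ 2 + 1)
    by (rewrite pow2_sqrt; nra).
  assert (Hp := sqrt_pos ((1 - lambda q / 2) ^ 2 + 1)).
  unfold rho; split; [|split]; nra.
Qed.

Lemma inv_hurwitz (q : nat) : (5 <= q)%nat ->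
  / hurwitz q = rho q + / rho q /\ / rho q = rho q + 2 - lambda q.
Proof.
  intros hq; pose proof (lambda_bounds q hq) as hl.
  destruct (rho_bounds q hq) as [Hr Hb].
  assert (H : / rho q = rho q + 2 - lambda q).
  { apply (Rmult_eq_reg_l (rho q)); [|lra]. rewrite Rinv_r; lra. }
  split; [|exact H].
  rewrite H; unfold hurwitz, rho.
  rewrite Rdiv_1_l, Rinv_inv. lra.
Qed.

Lemma hurwitz_pos (q : nat) : (5 <= q)%nat -> 0 < hurwitz q.
Proof.
  intros hq. pose proof (lambda_bounds q hq).
  destruct (rho_bounds q hq) as [Hr Hb]. destruct (inv_hurwitz q hq) as [HG HG'].
  rewrite <- (Rinv_inv (hurwitz q)), HG, HG'. apply Rinv_0_lt_compat. lra.
Qed.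

(** * Closed forms and monotonicity of [upper] and [lower] *)

Lemma sin_add_two_steps (a d : R) : sin (a + 2 * d) = 2 * cos d * sin (a + d) - sin a.
Proof.
  replace a with (a + d - d) at 3 by ring.
  replace (a + 2 * d) with (a + d + d) by ring.
  rewrite sin_plus, sin_minus. ring.
Qed.

(** For d = pi / (2q), lambda = 2 cos(2d), so sin(kd) obeys a linear recurrence in steps of two,
    whose quotients iterate z -> 1 / (lambda - z). The last values come from qd = pi / 2, which
    turns sines into cosines. *)
Lemma upper_facts (h q : nat) : (1 <= h)%nat -> q = (2 * h + 3)%nat ->
  upper q 0 = 0 /\ upper q 1 = / (1 + lambda q) /\
  upper q (2 * h) = lambda q - 1 /\ upper q (2 * h + 1) = lambda q / 2 /\
  (forall k, (k <= 2 * h + 1)%nat -> 0 <= upper q k < 1) /\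
  (forall k, (k + 2 <= 2 * h + 1)%nat -> upper q (k + 2) = / (lambda q - upper q k)).
Proof.
  intros hh hq.
  assert (hP := PI_RGT_0).
  set (d := PI / (2 * INR q)).
  assert (hq5 : INR q = 2 * INR h + 3).
  { rewrite hq, plus_INR, mult_INR. simpl. lra. }
  assert (hh' := pos_INR h).
  assert (hd : 0 < d) by (apply Rdiv_lt_0_compat; lra).
  assert (hdq : (2 * INR h + 3) * d = PI / 2) by (unfold d; rewrite hq5; field; lra).
  assert (hl : lambda q = 2 * cos (2 * d)).
  { unfold lambda, d. do 2 f_equal. field. lra. }
  assert (hl2 := lambda_bounds q ltac:(lia)).
  assert (hrange : forall k, (k <= 2 * h + 3)%nat -> 0 <= INR k * d <= PI / 2).
  { intros k hk. rewrite <- hdq. apply le_INR in hk. rewrite plus_INR, mult_INR in hk.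
    simpl in hk. pose proof (pos_INR k). split; nra. }
  assert (hpos : forall k, (0 < k <= 2 * h + 3)%nat -> 0 < sin (INR k * d)).
  { intros k [hk0 hk]. apply lt_INR in hk0. simpl in hk0. pose proof (hrange k hk).
    apply sin_gt_0; nra. }
  assert (hrec : forall k, sin (INR (k + 4) * d)
      = lambda q * sin (INR (k + 2) * d) - sin (INR k * d)).
  { intros k. rewrite hl, !plus_INR. simpl.
    replace ((INR k + (1 + 1 + 1 + 1)) * d) with (INR k * d + 2 * (2 * d)) by ring.
    rewrite sin_add_two_steps. do 3 f_equal. ring. }
  assert (hsd : sin (2 * d) = 2 * sin d * cos d) by apply sin_2a.
  assert (hs1 := hpos 1%nat ltac:(lia)). simpl in hs1. rewrite Rmult_1_l in hs1.
  assert (hs3 : sin (3 * d) = (1 + lambda q) * sin d).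
  { replace (3 * d) with (2 * d + d) by ring. rewrite sin_plus, hsd, hl, cos_2a_sin.
    pose proof (sin2_cos2 d) as E. unfold Rsqr in E. nra. }
  repeat split.
  - unfold upper. simpl. rewrite Rmult_0_l, sin_0. lra.
  - unfold upper. fold d. simpl. rewrite Rmult_1_l.
    replace ((1 + 1 + 1) * d) with (3 * d) by ring. rewrite hs3. field. lra.
  - unfold upper. fold d.
    assert (E2 : INR (2 * h + 2) * d = PI / 2 - d).
    { rewrite <- hdq, plus_INR, mult_INR. simpl. ring. }
    assert (E0 : INR (2 * h) * d = PI / 2 - 3 * d).
    { rewrite <- hdq, mult_INR. simpl. ring. }
    rewrite E2, E0, sin_shift, sin_shift.
    assert (hc : 0 < cos d) by (rewrite <- sin_shift, <- E2; apply hpos; lia).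
    assert (E3 : cos (3 * d) = (lambda q - 1) * cos d).
    { replace (3 * d) with (2 * d + d) by ring. rewrite cos_plus, hsd, hl, cos_2a_sin.
      pose proof (sin2_cos2 d) as E. unfold Rsqr in E. nra. }
    rewrite E3. field. lra.
  - unfold upper. fold d.
    replace (2 * h + 1 + 2)%nat with (2 * h + 3)%nat by lia.
    assert (E2 : INR (2 * h + 3) * d = PI / 2).
    { rewrite <- hdq, plus_INR, mult_INR. simpl. ring. }
    assert (E0 : INR (2 * h + 1) * d = PI / 2 - 2 * d).
    { rewrite <- hdq, plus_INR, mult_INR. simpl. ring. }
    rewrite E2, E0, sin_shift, sin_PI2, hl. field.
  - pose proof (hpos (k + 2)%nat ltac:(lia)) as H2. pose proof (hrange k ltac:(lia)) as H0.
    unfold upper. fold d. apply Rmult_le_pos; [apply sin_ge_0; lra|].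
    left; apply Rinv_0_lt_compat; assumption.
  - pose proof (hpos (k + 2)%nat ltac:(lia)) as H2. pose proof (hrange k ltac:(lia)) as H0.
    pose proof (hrange (k + 2)%nat ltac:(lia)) as H0'.
    unfold upper. fold d. apply (Rmult_lt_reg_r (sin (INR (k + 2) * d))); [assumption|].
    unfold Rdiv. rewrite Rmult_assoc, Rinv_l, Rmult_1_l, Rmult_1_r by lra.
    apply sin_increasing_1; try lra. rewrite plus_INR. simpl. nra.
  - intros k hk. unfold upper. fold d. replace (k + 2 + 2)%nat with (k + 4)%nat by lia.
    pose proof (hpos (k + 2)%nat ltac:(lia)) as H2.
    pose proof (hpos (k + 4)%nat ltac:(lia)) as H4.
    rewrite hrec in *. field. lra.
Qed.

Lemma lower_SS (q k : nat) : lower q (k + 2) = / (lambda q - lower q k).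
Proof. replace (k + 2)%nat with (S (S k)) by lia. reflexivity. Qed.

(** Both sequences iterate z -> 1 / (lambda - z), increasing for z < lambda, in steps of two; only
    the two starting values need comparison. *)
Lemma lower_bounds (h q k : nat) : (1 <= h)%nat -> q = (2 * h + 3)%nat ->
  (k <= 2 * h)%nat -> 0 < lower q k <= upper q (k + 1).
Proof.
  intros hh hq. destruct (upper_facts h q hh hq) as (U0 & U1 & Ua & Ub & Ur & US).
  destruct (rho_bounds q ltac:(lia)) as [Hr Hb].
  pose proof (lambda_bounds q ltac:(lia)) as hl.
  induction k as [k IH] using (well_founded_induction lt_wf). intros hk.
  destruct k as [|[|k]].
  - replace (0 + 1)%nat with 1%nat by lia. rewrite U1. simpl. split.
    + apply Rinv_0_lt_compat; lra.
    + apply Rinv_le_contravar; lra.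
  - replace (1 + 1)%nat with (0 + 2)%nat by lia. rewrite US, U0 by lia. simpl. split.
    + apply Rinv_0_lt_compat; lra.
    + apply Rinv_le_contravar; lra.
  - specialize (IH k ltac:(lia) ltac:(lia)).
    replace (S (S k) + 1)%nat with (k + 1 + 2)%nat by lia. rewrite US by lia.
    pose proof (Ur (k + 1)%nat ltac:(lia)).
    change (lower q (S (S k))) with (/ (lambda q - lower q k)). split.
    + apply Rinv_0_lt_compat; lra.
    + apply Rinv_le_contravar; lra.
Qed.

Lemma lower_lt_1 (h q k : nat) : (1 <= h)%nat -> q = (2 * h + 3)%nat ->
  (k <= 2 * h)%nat -> lower q k < 1.
Proof.
  intros hh hq hk. destruct (upper_facts h q hh hq) as (_ & _ & _ & _ & Ur & _).
  pose proof (Ur (k + 1)%nat ltac:(lia)). pose proof (lower_bounds h q k hh hq hk). lra.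
Qed.

(** The same increasing map propagates the order from the index pairs (0, 1) and (1, 2). *)
Lemma lower_incr (h q j k : nat) : (1 <= h)%nat -> q = (2 * h + 3)%nat ->
  (j <= k <= 2 * h)%nat -> lower q j <= lower q k.
Proof.
  intros hh hq [hjk hk].
  destruct (rho_bounds q ltac:(lia)) as [Hr Hb].
  pose proof (lambda_bounds q ltac:(lia)) as hl.
  assert (Hstep : forall i, (S i <= 2 * h)%nat -> lower q i <= lower q (S i)).
  { induction i as [i IH] using (well_founded_induction lt_wf). intros hi.
    destruct i as [|[|i]].
    - simpl. apply Rinv_le_contravar; lra.
    - pose proof (lower_bounds h q 0 hh hq ltac:(lia)).
      pose proof (lower_lt_1 h q 0 hh hq ltac:(lia)).
      change (/ (lambda q + rho q) <= / (lambda q - lower q 0)).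
      apply Rinv_le_contravar; lra.
    - pose proof (lower_lt_1 h q (S i) hh hq ltac:(lia)).
      specialize (IH i ltac:(lia) ltac:(lia)).
      change (/ (lambda q - lower q i) <= / (lambda q - lower q (S i))).
      apply Rinv_le_contravar; lra. }
  induction hjk as [|k hjk IH]; [lra|].
  apply Rle_trans with (lower q k); [apply IH|apply Hstep]; lia.
Qed.

(* The matrix of the [j]-th iterate of [z |-> 1 / (lambda - z)] has entries
   [sin (i * PI / q)]; cross-multiplied to avoid discussing the denominator. *)
Lemma lower_iterate (q i j : nat) : (forall k, (k < j)%nat -> lower q (i + 2 * k) < lambda q) ->
  lower q (i + 2 * j) *
    (sin ((INR j + 1) * (PI / INR q)) - lower q i * sin (INR j * (PI / INR q)))
  = sin (INR j * (PI / INR q)) - lower q i * sin ((INR j - 1) * (PI / INR q)).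
Proof.
  intros H; induction j as [|j IH].
  - replace (i + 2 * 0)%nat with i by lia. simpl.
    replace ((0 - 1) * (PI / INR q)) with (- (PI / INR q)) by ring.
    rewrite sin_neg, Rmult_0_l, sin_0, Rplus_0_l, Rmult_1_l. ring.
  - specialize (IH ltac:(intros; apply H; lia)). specialize (H j ltac:(lia)).
    replace (i + 2 * S j)%nat with (i + 2 * j + 2)%nat by lia. rewrite lower_SS.
    rewrite S_INR. set (d := PI / INR q) in *.
    replace ((INR j + 1 + 1) * d) with (INR j * d + 2 * d) by ring.
    replace ((INR j + 1 - 1) * d) with (INR j * d) by ring.
    assert (E : sin ((INR j + 1) * d) = lambda q * sin (INR j * d) - sin ((INR j - 1) * d)).
    { replace ((INR j + 1) * d) with ((INR j - 1) * d + 2 * d) by ring.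
      rewrite sin_add_two_steps. unfold lambda. fold d. do 3 f_equal. ring. }
    rewrite sin_add_two_steps. replace (INR j * d + d) with ((INR j + 1) * d) by ring.
    change (2 * cos d) with (lambda q).
    apply (Rmult_eq_reg_l (lambda q - lower q (i + 2 * j))); [|lra].
    rewrite <- Rmult_assoc, Rinv_r, Rmult_1_l by lra. nra.
Qed.

(** After [h] iterations the angles in [lower_iterate] are pi / 2 minus d / 2, 3d / 2 and 5d / 2,
    with d = pi / q, so the sines are polynomials in lambda times cos(d / 2). The resulting values
    are those for which the digit-2 steps close the cycle. *)
Lemma lower_ends (h q : nat) : (1 <= h)%nat -> q = (2 * h + 3)%nat ->
  lower q (2 * h) = lambda q - rho q /\ lower q (2 * h - 1) = 2 * lambda q - 2 - rho q.
Proof.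
  intros hh hq.
  destruct (rho_bounds q ltac:(lia)) as [Hr Hb].
  pose proof (lambda_bounds q ltac:(lia)) as hl.
  assert (hP := PI_RGT_0).
  set (d := PI / INR q).
  assert (hq5 : INR q = 2 * INR h + 3).
  { rewrite hq, plus_INR, mult_INR. simpl. lra. }
  assert (hh' := pos_INR h).
  assert (hdq : (2 * INR h + 3) * (d / 2) = PI / 2) by (unfold d; rewrite hq5; field; lra).
  assert (hd : 0 < d) by (apply Rdiv_lt_0_compat; lra).
  assert (E1 : (INR h + 1) * d = PI / 2 - d / 2) by lra.
  assert (E0 : INR h * d = PI / 2 - (- (d / 2) + 2 * d)) by lra.
  assert (Em : (INR h - 1) * d = PI / 2 - (d / 2 + 2 * d)) by lra.
  assert (hc : 0 < cos (d / 2)).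
  { apply cos_gt_0; nra. }
  assert (cstep : forall a, cos (a + 2 * d) = lambda q * cos (a + d) - cos a).
  { intros a. rewrite <- !sin_shift.
    replace (PI / 2 - a) with (PI / 2 - (a + 2 * d) + 2 * d) by ring.
    rewrite sin_add_two_steps. unfold lambda. fold d.
    replace (PI / 2 - (a + 2 * d) + d) with (PI / 2 - (a + d)) by ring. ring. }
  assert (C0 : cos (- (d / 2) + 2 * d) = (lambda q - 1) * cos (d / 2)).
  { rewrite cstep, cos_neg. replace (- (d / 2) + d) with (d / 2) by field. ring. }
  assert (Cm : cos (d / 2 + 2 * d) = (lambda q ^ 2 - lambda q - 1) * cos (d / 2)).
  { rewrite cstep. replace (d / 2 + d) with (- (d / 2) + 2 * d) by field. rewrite C0. ring. }
  assert (key : forall i, (i <= 1)%nat ->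
    lower q (i + 2 * h) * (1 - (lambda q - 1) * lower q i)
      = (lambda q - 1) - (lambda q ^ 2 - lambda q - 1) * lower q i).
  { intros i hi. pose proof (lower_iterate q i h) as H.
    fold d in H. rewrite E1, E0, Em, !sin_shift, C0, Cm in H.
    assert (H' : lower q (i + 2 * h) *
       (cos (d / 2) - lower q i * ((lambda q - 1) * cos (d / 2))) =
       (lambda q - 1) * cos (d / 2) -
       lower q i * ((lambda q ^ 2 - lambda q - 1) * cos (d / 2))).
    { apply H. intros k hk. pose proof (lower_lt_1 h q (i + 2 * k) hh hq ltac:(lia)). lra. }
    apply (Rmult_eq_reg_l (cos (d / 2))); [|lra]. lra. }
  split.
  - pose proof (key 0%nat ltac:(lia)) as K. simpl lower in K at 2 3.
    replace (0 + 2 * h)%nat with (2 * h)%nat in K by lia.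
    assert (K' : lower q (2 * h) * (3 - lambda q + rho q)
       = (lambda q - 1) * (rho q + 2) - (lambda q ^ 2 - lambda q - 1)).
    { apply (Rmult_eq_reg_l (/ (rho q + 2))); [|apply Rinv_neq_0_compat; lra].
      transitivity (lower q (2 * h) * (1 - (lambda q - 1) * / (rho q + 2))).
      - field; lra.
      - rewrite K. field; lra. }
    nra.
  (* The odd chain is evaluated at [2 * h + 1], one step past the cycle, and inverted once. *)
  - pose proof (key 1%nat ltac:(lia)) as K. simpl lower in K at 2 3.
    replace (1 + 2 * h)%nat with (2 * h - 1 + 2)%nat in K by lia. rewrite lower_SS in K.
    pose proof (lower_lt_1 h q (2 * h - 1) hh hq ltac:(lia)).
    set (m := lower q (2 * h - 1)) in *.
    assert (K' : (1 + rho q) = ((lambda q - 1) * (lambda q + rho q)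
         - (lambda q ^ 2 - lambda q - 1)) * (lambda q - m)).
    { apply (Rmult_eq_reg_l (/ (lambda q - m) * / (lambda q + rho q)));
        [|apply Rmult_integral_contrapositive; split; apply Rinv_neq_0_compat; lra].
      transitivity (/ (lambda q - m) * (1 - (lambda q - 1) * / (lambda q + rho q))).
      - field; lra.
      - rewrite K. field; lra. }
    (* By the quadratic for [rho q], the first factor on the right of [K'] is
       [rho q * (1 + rho q)]. *)
    assert (K2 : rho q * (lambda q - m) = 1).
    { apply (Rmult_eq_reg_l (1 + rho q)); [|lra]. nra. }
    nra.
Qed.

(** * The Rosen map and the invariance of its natural extension *)

(** The floor inequalities times lambda confine the remainder; the digit is positive because 1 / |t|
    > 1 > lambda / 2. *)
Lemma rosen_map_spec (q : nat) (t : R) : 0 < lambda q < 2 -> rosen_dom q t -> t <> 0 ->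
  (1 <= digit q t)%Z /\ rosen_dom q (rosen_map q t) /\
  / Rabs t = IZR (digit q t) * lambda q + rosen_map q t.
Proof.
  intros hl [ht1 ht2] ht0. set (r := digit q t).
  assert (ha : 0 < Rabs t) by (apply Rabs_pos_lt; assumption).
  assert (ha' : Rabs t <= lambda q / 2) by (apply Rabs_le; lra).
  assert (hi : 0 < / Rabs t) by (apply Rinv_0_lt_compat; assumption).
  assert (hm : rosen_map q t = / Rabs t - lambda q * IZR r).
  { unfold rosen_map, r. destruct (Req_dec_T t 0); [contradiction|]. lra. }
  destruct (base_Int_part (1 / (lambda q * Rabs t) + 1 / 2)) as [H1 H2].
  change (Int_part (1 / (lambda q * Rabs t) + 1 / 2)) with r in H1, H2.
  assert (E : lambda q * (1 / (lambda q * Rabs t) + 1 / 2) = / Rabs t + lambda q / 2)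
    by (field; lra).
  assert (H3 : lambda q * IZR r <= / Rabs t + lambda q / 2).
  { rewrite <- E. apply Rmult_le_compat_l; lra. }
  assert (H4 : / Rabs t + lambda q / 2 < lambda q * (IZR r + 1)).
  { rewrite <- E. apply Rmult_lt_compat_l; lra. }
  assert (H5 : 1 < / Rabs t).
  { rewrite <- Rinv_1. apply Rinv_lt_contravar; lra. }
  split; [|split; [unfold rosen_dom|]; lra].
  assert (0 < r)%Z; [|lia]. apply lt_IZR.
  apply Rnot_le_lt; intros H6. nra.
Qed.

Lemma IZR_ge_cases (r : Z) : (1 <= r)%Z -> r = 1%Z \/ r = 2%Z \/ 3 <= IZR r.
Proof.
  intros H. destruct (Z.eq_dec r 1) as [|H1]; [auto|].
  destruct (Z.eq_dec r 2) as [|H2]; [auto|].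
  right; right. apply IZR_le. lia.
Qed.

(* The natural extension of the Rosen map lives on a union of rectangles: over
   the points left of [- upper q k], the second coordinate is at most
   [lower q (2 * h - k)]. *)
Definition nat_ext (h q : nat) (t v : R) : Prop :=
  0 <= v /\ forall k, (k <= 2 * h)%nat -> t < - upper q k -> v <= lower q (2 * h - k).

Lemma nat_ext_neg (h q : nat) (t v : R) : (1 <= h)%nat -> q = (2 * h + 3)%nat ->
  nat_ext h q t v -> t < 0 -> 0 <= v <= lambda q - rho q.
Proof.
  intros hh hq [Hv HI] ht. split; [assumption|].
  destruct (upper_facts h q hh hq) as (U0 & _).
  destruct (lower_ends h q hh hq) as [<- _].
  specialize (HI 0%nat ltac:(lia)). rewrite U0, Nat.sub_0_r in HI. apply HI. lra.
Qed.

Lemma nat_ext_neg1 (h q : nat) (t v : R) : (1 <= h)%nat -> q = (2 * h + 3)%nat ->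
  nat_ext h q t v -> t < - / (1 + lambda q) -> v <= 2 * lambda q - 2 - rho q.
Proof.
  intros hh hq [Hv HI] ht.
  destruct (upper_facts h q hh hq) as (_ & U1 & _).
  destruct (lower_ends h q hh hq) as [_ <-].
  apply (HI 1%nat ltac:(lia)). rewrite U1. exact ht.
Qed.

(** For t < 0 with digit 1, strip [k] of the image pulls back to strip [k + 2], and inverting
    [lambda q - v] raises the index of [lower] by two. In the other cases the denominator is large
    enough for a bound by [lower] at 0, 1 or 2. *)
Lemma nat_ext_step (h q : nat) (t v : R) : (1 <= h)%nat -> q = (2 * h + 3)%nat ->
  rosen_dom q t -> t <> 0 -> nat_ext h q t v ->
  0 < IZR (digit q t) * lambda q + eps t * v /\
  nat_ext h q (rosen_map q t) (/ (IZR (digit q t) * lambda q + eps t * v)).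
Proof.
  intros hh hq hdom ht0 HI.
  destruct (upper_facts h q hh hq) as (U0 & U1 & Ua & Ub & Ur & US).
  destruct (rho_bounds q ltac:(lia)) as [Hr Hb].
  pose proof (lambda_bounds q ltac:(lia)) as hl.
  destruct (rosen_map_spec q t ltac:(lra) hdom ht0) as (hr1 & hdom' & Et).
  pose proof (lower_bounds h q 0 hh hq ltac:(lia)) as [L0p _].
  pose proof (lower_lt_1 h q 0 hh hq ltac:(lia)) as L0l.
  assert (L0 : forall k, (k <= 2 * h)%nat -> / (rho q + 2) <= lower q (2 * h - k)).
  { intros k hk. apply (lower_incr h q 0 (2 * h - k) hh hq). lia. }
  assert (L1 : forall k, (k < 2 * h)%nat -> / (lambda q + rho q) <= lower q (2 * h - k)).
  { intros k hk. apply (lower_incr h q 1 (2 * h - k) hh hq). lia. }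
  assert (hr : 1 <= IZR (digit q t)) by (apply IZR_le in hr1; exact hr1).
  unfold rosen_dom in hdom, hdom'.
  set (t' := rosen_map q t) in *. set (r := digit q t) in *.
  assert (Hv : 0 <= v) by apply HI.
  unfold eps. destruct (Rlt_dec t 0) as [ht|ht].
  - rewrite Rabs_left in Et by assumption.
    pose proof (nat_ext_neg h q t v hh hq HI ht) as HP.
    assert (Es : t = - / (IZR r * lambda q + t')).
    { rewrite <- Et, Rinv_inv. lra. }
    assert (hden : 0 < IZR r * lambda q + -1 * v) by nra.
    split; [assumption|]. split; [left; apply Rinv_0_lt_compat; assumption|].
    intros k hk hk'. destruct (IZR_ge_cases r hr1) as [E|[E|E]]; try rewrite E in *.
    + rewrite Rmult_1_l in *. pose proof (Ur k ltac:(lia)) as Uk.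
      assert (Hlt : (k + 2 <= 2 * h + 1)%nat -> t < - upper q (k + 2)).
      { intros hk2. rewrite US by assumption. rewrite Es.
        apply Ropp_lt_contravar. apply Rinv_lt_contravar; nra. }
      destruct (Nat.le_gt_cases (k + 2) (2 * h)) as [hk2|hk2].
      * replace (2 * h - k)%nat with (2 * h - (k + 2) + 2)%nat by lia.
        rewrite lower_SS.
        pose proof (lower_lt_1 h q (2 * h - (k + 2)) hh hq ltac:(lia)).
        destruct HI as [_ HI]. specialize (HI (k + 2)%nat hk2 (Hlt ltac:(lia))).
        apply Rinv_le_contravar; lra.
      (* For [k = 2 * h - 1] the point would lie left of the domain; for [k = 2 * h] the image would
         be below 1 - lambda, forcing |t| > 1. *)
      * exfalso. assert (k = 2 * h - 1 \/ k = 2 * h)%nat as [Ek|Ek] by lia.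
        -- specialize (Hlt ltac:(lia)).
           replace (k + 2)%nat with (2 * h + 1)%nat in Hlt by lia. lra.
        -- subst k. rewrite Ua in *.
           assert (lambda q / 2 < / (lambda q + t')); [|lra].
           apply (Rmult_lt_reg_r (lambda q + t')); [lra|]. rewrite Rinv_l by lra. nra.
    (* Only the last strip needs more than v <= lambda - rho: there t < -1 / (1 + lambda), where the
       sharper bound on [v] holds. *)
    + destruct (Nat.eq_dec k (2 * h)) as [->|hk2].
      * rewrite Nat.sub_diag. simpl. rewrite Ua in hk'.
        assert (t < - / (1 + lambda q)).
        { rewrite Es. apply Ropp_lt_contravar. apply Rinv_lt_contravar; nra. }
        pose proof (nat_ext_neg1 h q t v hh hq HI ltac:(assumption)).
        apply Rinv_le_contravar; lra.
      * eapply Rle_trans; [|apply L1; lia]. apply Rinv_le_contravar; lra.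
    + eapply Rle_trans; [|apply L0; lia]. apply Rinv_le_contravar; nra.
  - assert (ht' : 0 < t) by lra. rewrite Rabs_pos_eq in Et by lra.
    assert (hden : 0 < IZR r * lambda q + 1 * v) by nra.
    split; [assumption|]. split; [left; apply Rinv_0_lt_compat; assumption|].
    intros k hk hk'. destruct (IZR_ge_cases r hr1) as [E|E].
    + rewrite E, Rmult_1_l in *.
      assert (Es : t = / (lambda q + t')) by (rewrite <- Et, Rinv_inv; reflexivity).
      pose proof (Ur k ltac:(lia)) as Uk.
      assert (Hlt : (k + 2 <= 2 * h)%nat).
      { destruct (Nat.le_gt_cases (k + 2) (2 * h)) as [hk2|hk2]; [assumption|exfalso].
        assert (k = 2 * h - 1 \/ k = 2 * h)%nat as [Ek|Ek] by lia.
        - assert (upper q (k + 2) < t).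
          { rewrite US, Es by lia. apply Rinv_lt_contravar; nra. }
          replace (k + 2)%nat with (2 * h + 1)%nat in * by lia. lra.
        - subst k. rewrite Ua in *.
          assert (lambda q / 2 < / (lambda q + t')); [|lra].
          apply (Rmult_lt_reg_r (lambda q + t')); [lra|]. rewrite Rinv_l by lra. nra. }
      apply Rle_trans with (lower q (0 + 2)); [|apply (lower_incr h); lia].
      rewrite lower_SS. apply Rinv_le_contravar; lra.
    (* This needs rho + 2 <= 2 lambda: the quadratic for rho takes the value 2 lambda^2 - 2 lambda -
       1 at 2 lambda - 2, positive for lambda > 7/5. *)
    + assert (2 <= IZR r) by (destruct E as [->|E]; lra).
      eapply Rle_trans; [|apply L0; lia]. apply Rinv_le_contravar; nra.
Qed.

(** * Orbits, convergents and the formula for [Theta] *)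

Lemma orbit_dom (q : nat) (x : R) (n : nat) : 0 < lambda q < 2 ->
  rosen_dom q x -> Gq_irrational q x -> rosen_dom q (orbit q x n).
Proof.
  intros hl hx hi. induction n as [|n IH]; [exact hx|].
  change (rosen_dom q (rosen_map q (orbit q x n))).
  apply rosen_map_spec; try assumption. intros E. apply hi. exists n; exact E.
Qed.

Definition back (q : nat) (x : R) (n : nat) : R :=
  fst (rosen_rec q x 0 1 n) / snd (rosen_rec q x 0 1 n).

Lemma rosen_rec_S (q : nat) (x a b : R) (n : nat) :
  rosen_rec q x a b (S n) =
    (snd (rosen_rec q x a b n),
     IZR (digit q (orbit q x n)) * lambda q * snd (rosen_rec q x a b n)
       + eps (orbit q x n) * fst (rosen_rec q x a b n)).
Proof. simpl. destruct (rosen_rec q x a b n). reflexivity. Qed.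

(** Positivity of the denominators and membership in the natural extension go by one induction: each
    new denominator is the old one times a factor whose positivity rests on the bound for v_n. *)
Lemma back_nat_ext (h q : nat) (x : R) (n : nat) : (1 <= h)%nat -> q = (2 * h + 3)%nat ->
  rosen_dom q x -> Gq_irrational q x ->
  0 < conv_den q x n /\ nat_ext h q (orbit q x n) (back q x n) /\
  back q x (S n)
    = / (IZR (digit q (orbit q x n)) * lambda q + eps (orbit q x n) * back q x n).
Proof.
  intros hh hq hx hi. pose proof (lambda_bounds q ltac:(lia)) as hl.
  assert (hn0 : forall n, orbit q x n <> 0) by (intros m E; apply hi; exists m; exact E).
  assert (Hstep : forall n, 0 < conv_den q x n -> nat_ext h q (orbit q x n) (back q x n) ->
    0 < conv_den q x (S n) /\ back q x (S n)
    = / (IZR (digit q (orbit q x n)) * lambda q + eps (orbit q x n) * back q x n)).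
  { intros m Hd HI.
    destruct (nat_ext_step h q _ _ hh hq (orbit_dom q x m ltac:(lra) hx hi) (hn0 m) HI)
      as [Hp _].
    unfold conv_den in *. unfold back in *. rewrite rosen_rec_S. simpl fst; simpl snd.
    set (S1 := snd (rosen_rec q x 0 1 m)) in *. set (S0 := fst (rosen_rec q x 0 1 m)) in *.
    set (r := IZR (digit q (orbit q x m))) in *. set (e := eps (orbit q x m)) in *.
    assert (E : r * lambda q * S1 + e * S0 = S1 * (r * lambda q + e * (S0 / S1)))
      by (field; lra).
    rewrite E. revert Hp. generalize (r * lambda q + e * (S0 / S1)). intros W Hp.
    split; [nra|]. field. split; lra. }
  assert (H : 0 < conv_den q x n /\ nat_ext h q (orbit q x n) (back q x n)).
  { induction n as [|n [IH1 IH2]].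
    - unfold conv_den, back. simpl. split; [lra|].
      replace (0 / 1) with 0 by field. split; [lra|]. intros k hk _. left.
      apply (lower_bounds h); lia.
    - destruct (Hstep n IH1 IH2) as [H1 H2]. split; [assumption|]. rewrite H2.
      apply nat_ext_step; try assumption; [apply orbit_dom; try assumption; lra|apply hn0]. }
  destruct H as [H1 H2]. repeat split; try assumption; try apply H2.
  apply Hstep; assumption.
Qed.

(** [x] is the image of t_n under the Moebius map of the convergents, here cross-multiplied. The
    determinant is a product of signs; squaring it avoids tracking them. *)
Lemma rosen_rec_numden (q : nat) (x : R) (n : nat) : 0 < lambda q < 2 ->
  rosen_dom q x -> Gq_irrational q x ->
  x * (snd (rosen_rec q x 0 1 n) + orbit q x n * fst (rosen_rec q x 0 1 n))
    = snd (rosen_rec q x 1 0 n) + orbit q x n * fst (rosen_rec q x 1 0 n) /\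
  (fst (rosen_rec q x 1 0 n) * snd (rosen_rec q x 0 1 n)
    - snd (rosen_rec q x 1 0 n) * fst (rosen_rec q x 0 1 n)) ^ 2 = 1.
Proof.
  intros hl hx hi. induction n as [|n [IH1 IH2]].
  - simpl. unfold orbit. simpl. split; ring.
  - assert (ht0 : orbit q x n <> 0) by (intros E; apply hi; exists n; exact E).
    destruct (rosen_map_spec q (orbit q x n) hl (orbit_dom q x n hl hx hi) ht0)
      as (_ & _ & E).
    rewrite !rosen_rec_S. simpl fst; simpl snd.
    change (orbit q x (S n)) with (rosen_map q (orbit q x n)).
    set (t := orbit q x n) in *. set (t' := rosen_map q t) in *.
    set (r := IZR (digit q t)) in *.
    set (S1 := snd (rosen_rec q x 0 1 n)) in *. set (S0 := fst (rosen_rec q x 0 1 n)) in *.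
    set (R1 := snd (rosen_rec q x 1 0 n)) in *. set (R0 := fst (rosen_rec q x 1 0 n)) in *.
    (* In this form of [eps t] the factor [r * lambda q + t'] splits off the new numerator and
       denominator. *)
    assert (Ee : eps t = t * (r * lambda q + t') /\ eps t ^ 2 = 1).
    { rewrite <- E. unfold eps. destruct (Rlt_dec t 0).
      - rewrite Rabs_left by assumption. split; [field; lra|ring].
      - rewrite Rabs_pos_eq by lra. split; [field; lra|ring]. }
    destruct Ee as [Ee E2]. split.
    + transitivity ((r * lambda q + t') * (x * (S1 + t * S0))).
      * rewrite Ee. ring.
      * rewrite IH1, Ee. ring.
    + transitivity (eps t ^ 2 * (R0 * S1 - R1 * S0) ^ 2); [ring|].
      rewrite E2, IH2. ring.
Qed.

(** The difference x - R_n / S_n is t_n times the determinant over S_n (S_n + t_n S_(n-1)), and S_n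
    + t_n S_(n-1) = S_n |t_n| W with W the inverted expression. *)
Lemma Theta_eq (h q : nat) (x : R) (n : nat) : (1 <= h)%nat -> q = (2 * h + 3)%nat ->
  rosen_dom q x -> Gq_irrational q x ->
  0 < / Rabs (orbit q x n) + eps (orbit q x n) * back q x n /\
  Theta q x n = / (/ Rabs (orbit q x n) + eps (orbit q x n) * back q x n).
Proof.
  intros hh hq hx hi. pose proof (lambda_bounds q ltac:(lia)) as hl.
  assert (ht0 : orbit q x n <> 0) by (intros E; apply hi; exists n; exact E).
  destruct (rho_bounds q ltac:(lia)) as [Hr Hb].
  pose proof (orbit_dom q x n ltac:(lra) hx hi) as hdom.
  destruct (rosen_rec_numden q x n ltac:(lra) hx hi) as [E1 E2].
  destruct (back_nat_ext h q x n hh hq hx hi) as (Hd & HI & _).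
  assert (Hp : 0 < / Rabs (orbit q x n) + eps (orbit q x n) * back q x n).
  { assert (ha : 0 < / Rabs (orbit q x n)) by (apply Rinv_0_lt_compat, Rabs_pos_lt; assumption).
    unfold eps. destruct (Rlt_dec (orbit q x n) 0) as [ht|ht].
    - pose proof (nat_ext_neg h q _ _ hh hq HI ht). rewrite Rabs_left in * by assumption.
      assert (1 < / - orbit q x n); [|lra].
      unfold rosen_dom in hdom. rewrite <- Rinv_1. apply Rinv_lt_contravar; lra.
    - pose proof (proj1 HI). lra. }
  split; [exact Hp|].
  unfold Theta, conv_num, back, conv_den in *.
  set (t := orbit q x n) in *.
  set (S1 := snd (rosen_rec q x 0 1 n)) in *. set (S0 := fst (rosen_rec q x 0 1 n)) in *.
  set (R1 := snd (rosen_rec q x 1 0 n)) in *. set (R0 := fst (rosen_rec q x 1 0 n)) in *.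
  assert (ha : 0 < Rabs t) by (apply Rabs_pos_lt; assumption).
  assert (Ee : eps t * Rabs t = t).
  { unfold eps. destruct (Rlt_dec t 0); [rewrite Rabs_left|rewrite Rabs_pos_eq]; lra. }
  assert (EW : S1 + t * S0 = S1 * Rabs t * (/ Rabs t + eps t * (S0 / S1))).
  { rewrite <- Ee at 1. field. lra. }
  set (W := / Rabs t + eps t * (S0 / S1)) in *.
  assert (E3 : S1 ^ 2 * (x - R1 / S1) * W * Rabs t = t * (R0 * S1 - R1 * S0)).
  { transitivity (S1 * (x * (S1 * Rabs t * W)) - R1 * (S1 * Rabs t * W)); [field; lra|].
    rewrite <- EW, E1. ring. }
  assert (E4 : Rabs (R0 * S1 - R1 * S0) = 1).
  { rewrite <- Rsqr_pow2 in E2. rewrite <- sqrt_Rsqr_abs, E2. apply sqrt_1. }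
  apply (f_equal Rabs) in E3. rewrite !Rabs_mult, E4, Rabs_Rabsolu in E3.
  rewrite (Rabs_pos_eq W), (Rabs_pos_eq (S1 ^ 2)) in E3 by nra.
  apply (Rmult_eq_reg_r (W * Rabs t)); [|nra].
  transitivity (Rabs t); [lra|field; lra].
Qed.

(** * Repulsion from the extremal cycle *)

Definition trapped (h q k : nat) (t : R) : Prop :=
  (k <= 2 * h)%nat /\ lower q k < - t <= upper q (k + 1).

(** The interval forces the digit, and [k] moves to [k - 2], or from 0 to [2 * h - 1] and from 1 to
    [2 * h]. With s = -t and m = [lower q k], the new gap is 1 / m - 1 / s = (s - m) / (s m), where
    s m <= lambda / 2. *)
Lemma trapped_step (h q k : nat) (t : R) : (1 <= h)%nat -> q = (2 * h + 3)%nat ->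
  rosen_dom q t -> rosen_map q t < 0 -> trapped h q k t ->
  exists k', trapped h q k' (rosen_map q t) /\
    2 / lambda q * (- t - lower q k) <= - rosen_map q t - lower q k'.
Proof.
  intros hh hq hdom ht' [hk [H1 H2]].
  destruct (upper_facts h q hh hq) as (U0 & U1 & Ua & Ub & Ur & US).
  destruct (lower_ends h q hh hq) as [La Lb].
  destruct (rho_bounds q ltac:(lia)) as [Hr Hb].
  pose proof (lambda_bounds q ltac:(lia)) as hl.
  pose proof (lower_bounds h q k hh hq hk) as [Lp _].
  pose proof (lower_lt_1 h q k hh hq hk) as Ll.
  destruct (rosen_map_spec q t ltac:(lra) hdom ltac:(lra)) as (hr1 & hdom' & Et).
  rewrite Rabs_left in Et by lra. unfold rosen_dom in hdom, hdom'.
  set (t' := rosen_map q t) in *. set (r := digit q t) in *.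
  set (s := - t) in *. assert (Est : t = - s) by (unfold s; ring). clearbody s.
  set (m := lower q k) in *.
  assert (Hlt : / s < / m) by (apply Rinv_lt_contravar; nra).
  assert (Hexp : forall m', / m - / s = - t' - m' -> 2 / lambda q * (s - m) <= - t' - m').
  { intros m' <-. apply (Rmult_le_reg_r (lambda q * (s * m)));
      [apply Rmult_lt_0_compat; [lra|apply Rmult_lt_0_compat; lra]|].
    replace (2 / lambda q * (s - m) * (lambda q * (s * m))) with (2 * (s * m) * (s - m))
      by (field; lra).
    replace ((/ m - / s) * (lambda q * (s * m))) with (lambda q * (s - m)) by (field; split; lra).
    assert (s * m <= lambda q / 2) by nra. nra. }
  assert (hr : r = 1%Z \/ 2 <= IZR r).
  { destruct (IZR_ge_cases r hr1) as [->|[->|]]; [left|right|right]; auto; lra. }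
  destruct k as [|[|k]].
  - assert (Em : / m = rho q + 2) by apply Rinv_inv.
    assert (Hs : 1 + lambda q <= / s).
    { rewrite <- (Rinv_inv (1 + lambda q)), <- U1. apply Rinv_le_contravar; [lra|exact H2]. }
    assert (E : r = 2%Z).
    { destruct (IZR_ge_cases r hr1) as [E|[E|E]]; [|assumption|].
      - rewrite E in *. lra.
      - pose proof (lower_bounds h q (2 * h - 1) hh hq ltac:(lia)). nra. }
    rewrite E in *. exists (2 * h - 1)%nat. split.
    + split; [lia|]. replace (2 * h - 1 + 1)%nat with (2 * h)%nat by lia.
      rewrite Lb, Ua. lra.
    + apply Hexp. rewrite Lb. lra.
  - assert (Em : / m = lambda q + rho q) by apply Rinv_inv.
    assert (Hs : lambda q <= / s).
    { replace (1 + 1)%nat with (0 + 2)%nat in H2 by lia.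
      rewrite US, U0, Rminus_0_r in H2 by lia.
      rewrite <- (Rinv_inv (lambda q)). apply Rinv_le_contravar; [lra|exact H2]. }
    assert (E : r = 2%Z).
    { destruct (IZR_ge_cases r hr1) as [E|[E|E]]; [|assumption|].
      - rewrite E in *. lra.
      - nra. }
    rewrite E in *. exists (2 * h)%nat. split.
    + split; [lia|]. rewrite La, Ub. lra.
    + apply Hexp. rewrite La. lra.
  - assert (Em : / m = lambda q - lower q k) by apply Rinv_inv.
    pose proof (lower_bounds h q k hh hq ltac:(lia)) as Lk.
    pose proof (Ur (k + 1)%nat ltac:(lia)).
    replace (S (S k) + 1)%nat with (k + 1 + 2)%nat in H2 by lia.
    rewrite US in H2 by lia.
    assert (Hs : lambda q - upper q (k + 1) <= / s).
    { rewrite <- (Rinv_inv (lambda q - upper q (k + 1))).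
      apply Rinv_le_contravar; [lra|exact H2]. }
    assert (E : r = 1%Z).
    { destruct hr as [E|E]; [assumption|]. nra. }
    rewrite E in *. exists k. split.
    + split; [lia|]. lra.
    + apply Hexp. lra.
Qed.

Lemma orbit_not_trapped (h q k n : nat) (x : R) : (1 <= h)%nat -> q = (2 * h + 3)%nat ->
  rosen_dom q x -> Gq_irrational q x ->
  (forall m, (n <= m)%nat -> orbit q x m < 0) -> ~ trapped h q k (orbit q x n).
Proof.
  intros hh hq hx hi Hneg H0.
  pose proof (lambda_bounds q ltac:(lia)) as hl.
  set (e := - orbit q x n - lower q k).
  set (c := 2 / lambda q - 1).
  assert (He : 0 < e) by (unfold e; destruct H0; lra).
  assert (Hc : 0 < c).
  { unfold c. assert (1 < 2 / lambda q); [|lra].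
    apply (Rmult_lt_reg_r (lambda q)); [lra|]. field_simplify; lra. }
  (* A linear lower bound for the geometric growth, as in Bernoulli's inequality, already leaves the
     domain. *)
  assert (G : forall j, exists k', trapped h q k' (orbit q x (n + j)) /\
    e * (1 + INR j * c) <= - orbit q x (n + j) - lower q k').
  { induction j as [|j [k' [T1 T2]]].
    - exists k. rewrite Nat.add_0_r. split; [assumption|]. simpl. unfold e in *. lra.
    - pose proof (Hneg (n + S j)%nat ltac:(lia)) as Hn.
      rewrite Nat.add_succ_r in Hn |- *.
      destruct (trapped_step h q k' (orbit q x (n + j)) hh hq
        (orbit_dom q x _ ltac:(lra) hx hi) Hn T1) as [k'' [T3 T4]].
      exists k''. split; [exact T3|].
      change (rosen_map q (orbit q x (n + j))) with (orbit q x (S (n + j))) in T4.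
      rewrite S_INR. pose proof (pos_INR j) as Hj.
      replace (2 / lambda q) with (1 + c) in T4 by (unfold c; ring).
      eapply Rle_trans; [|exact T4].
      assert (0 <= e * (INR j * c)) by (apply Rmult_le_pos; [lra|apply Rmult_le_pos; lra]).
      nra. }
  destruct (INR_unbounded (1 / (e * c))) as [j Hj].
  destruct (G j) as [k' [[hk' [T1 _]] T2]].
  pose proof (lower_bounds h q k' hh hq hk') as [Lp _].
  pose proof (orbit_dom q x (n + j) ltac:(lra) hx hi) as [hd _].
  assert (Hec : 0 < e * c) by (apply Rmult_lt_0_compat; assumption).
  apply (Rmult_lt_compat_r (e * c)) in Hj; [|assumption].
  replace (1 / (e * c) * (e * c)) with 1 in Hj by (field; lra).
  nra.
Qed.

(** While digits are 1, a bound of -t_n by [upper q k] passes to [k - 2]. It ends at [k = 0] or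
    [k = 1], where digit 1 and a negative next point are incompatible. The start [2 * h + 1] is the
    end of the domain. *)
Lemma orbit_digit_ge_2 (h q n : nat) (x : R) : (1 <= h)%nat -> q = (2 * h + 3)%nat ->
  rosen_dom q x -> Gq_irrational q x ->
  (forall m, (n <= m)%nat -> orbit q x m < 0) ->
  exists m, (n <= m)%nat /\ (2 <= digit q (orbit q x m))%Z.
Proof.
  intros hh hq hx hi.
  destruct (upper_facts h q hh hq) as (U0 & U1 & Ua & Ub & Ur & US).
  pose proof (lambda_bounds q ltac:(lia)) as hl.
  assert (G : forall k, (k <= 2 * h + 1)%nat -> forall n,
    (forall m, (n <= m)%nat -> orbit q x m < 0) -> - orbit q x n <= upper q k ->
    exists m, (n <= m)%nat /\ (2 <= digit q (orbit q x m))%Z).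
  { clear n.
    induction k as [k IH] using (well_founded_induction lt_wf). intros hk n Hneg Hle.
    pose proof (Hneg n ltac:(lia)) as Hn. pose proof (Hneg (S n) ltac:(lia)) as Hn'.
    destruct (rosen_map_spec q _ ltac:(lra) (orbit_dom q x n ltac:(lra) hx hi) ltac:(lra))
      as (hr1 & hdom' & Et).
    change (rosen_map q (orbit q x n)) with (orbit q x (S n)) in *.
    rewrite Rabs_left in Et by assumption. unfold rosen_dom in hdom'.
    destruct (IZR_ge_cases _ hr1) as [E|[E|E]].
    - rewrite E, Rmult_1_l in Et. assert (Hs0 : 0 < - orbit q x n) by lra.
      set (s := - orbit q x n) in *.
      assert (Hs : s * (lambda q + orbit q x (S n)) = 1).
      { rewrite <- Et. apply Rinv_r. lra. }
      destruct k as [|[|k]].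
      + lra.
      + rewrite U1 in Hle. assert (s * (1 + lambda q) <= 1); [|nra].
        apply (Rmult_le_compat_r (1 + lambda q)) in Hle; [|lra].
        rewrite Rinv_l in Hle; lra.
      + replace (S (S k)) with (k + 2)%nat in Hle by lia. rewrite US in Hle by lia.
        pose proof (Ur k ltac:(lia)).
        apply (Rmult_le_compat_r (lambda q - upper q k)) in Hle; [|lra].
        rewrite Rinv_l in Hle by lra.
        destruct (IH k ltac:(lia) ltac:(lia) (S n)) as [m [hm Hm]].
        * intros m hm. apply Hneg. lia.
        * unfold s in *; nra.
        * exists m. split; [lia|assumption].
    - exists n. split; lia.
    - exists n. split; [lia|]. apply le_IZR. lra. }
  intros Hneg. apply (G (2 * h + 1)%nat); try lia; [assumption|]. rewrite Ub.
  pose proof (orbit_dom q x n ltac:(lra) hx hi) as [Hd _]. lra.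
Qed.

(** * Infinitely many small approximation coefficients *)

(** With t = t_(n+1) > 0, D = 1 / v_(n+1) and G = 1 / H_q, the assumptions read t + D < G and 1 / t
    + 1 / D < G. Eliminating D gives (G - t)(G - 1 / t) > 1, that is t + 1 / t < G = rho + 1 / rho,
    against t < rho < 1. *)
Lemma tail_neg (h q n : nat) (x : R) : (1 <= h)%nat -> q = (2 * h + 3)%nat ->
  rosen_dom q x -> Gq_irrational q x ->
  hurwitz q < Theta q x n -> hurwitz q < Theta q x (S n) -> orbit q x (S n) < 0.
Proof.
  intros hh hq hx hi H1 H2.
  assert (ht0 : forall n, orbit q x n <> 0) by (intros m E; apply hi; exists m; exact E).
  destruct (rho_bounds q ltac:(lia)) as [Hr Hb].
  pose proof (lambda_bounds q ltac:(lia)) as hl.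
  destruct (inv_hurwitz q ltac:(lia)) as [HG HG'].
  destruct (Theta_eq h q x n hh hq hx hi) as [W1 T1].
  destruct (Theta_eq h q x (S n) hh hq hx hi) as [W2 T2].
  destruct (back_nat_ext h q x n hh hq hx hi) as (_ & HI & Hv).
  pose proof (orbit_dom q x n ltac:(lra) hx hi) as hdom.
  pose proof (orbit_dom q x (S n) ltac:(lra) hx hi) as [_ hdom'].
  destruct (nat_ext_step h q _ _ hh hq hdom (ht0 n) HI) as [Hden _].
  destruct (rosen_map_spec q _ ltac:(lra) hdom (ht0 n)) as (_ & _ & Et).
  change (rosen_map q (orbit q x n)) with (orbit q x (S n)) in *.
  apply Rnot_le_lt; intros Hge.
  assert (Hpos : 0 < orbit q x (S n)) by (pose proof (ht0 (S n)); lra).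
  pose proof (hurwitz_pos q ltac:(lia)) as Hh.
  rewrite T1 in H1. rewrite T2 in H2.
  apply Rinv_lt_contravar in H1, H2;
    try (apply Rmult_lt_0_compat; [assumption|apply Rinv_0_lt_compat; assumption]).
  rewrite Rinv_inv, HG, Et in H1. rewrite Rinv_inv, HG in H2.
  unfold eps in H2. destruct (Rlt_dec (orbit q x (S n)) 0); [lra|].
  rewrite Rabs_pos_eq, Hv, Rmult_1_l in H2 by lra.
  set (D := IZR (digit q (orbit q x n)) * lambda q + eps (orbit q x n) * back q x n) in *.
  set (t := orbit q x (S n)) in *.
  assert (E : t + / t < rho q + / rho q).
  { assert (HDD : D * / D = 1) by (apply Rinv_r; lra).
    assert (Htt : t * / t = 1) by (apply Rinv_r; lra).
    assert (HDi := Rinv_0_lt_compat D Hden). assert (Hti := Rinv_0_lt_compat t Hpos).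
    set (G := rho q + / rho q) in *.
    assert (A1 : 0 < (G - / t - / D) * D) by (apply Rmult_lt_0_compat; lra).
    assert (A2 : 0 < (G - / t) * (G - t - D)) by (apply Rmult_lt_0_compat; unfold D; lra).
    assert (A3 : 0 < G * (G - (t + / t))) by nra.
    assert (0 < G) by lra. nra. }
  assert (Htr : t < rho q) by lra.
  assert (0 < (rho q - t) * (/ t * / rho q - 1)).
  { apply Rmult_lt_0_compat; [lra|].
    assert (1 < / t * / rho q); [|lra].
    rewrite <- Rinv_mult, <- Rinv_1. apply Rinv_lt_contravar; nra. }
  assert ((rho q - t) * (/ t * / rho q - 1) = t + / t - (rho q + / rho q)) by (field; lra).
  lra.
Qed.

Lemma Theta_le_hurwitz_infinitely (h q : nat) (x : R) : (1 <= h)%nat -> q = (2 * h + 3)%nat ->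
  rosen_dom q x -> Gq_irrational q x ->
  infinitely_many (fun n => Theta q x n <= hurwitz q).
Proof.
  intros hh hq hx hi N.
  destruct (classic (exists n, (N <= n)%nat /\ Theta q x n <= hurwitz q))
    as [H|H]; [exact H|exfalso].
  assert (HT : forall n, (N <= n)%nat -> hurwitz q < Theta q x n).
  { intros n hn. apply Rnot_le_lt. intros Hle. apply H. exists n. split; assumption. }
  clear H.
  assert (Hneg : forall n, (S N <= n)%nat -> orbit q x n < 0).
  { intros [|n] hn; [lia|]. apply (tail_neg h); try assumption; apply HT; lia. }
  destruct (orbit_digit_ge_2 h q (S N) x hh hq hx hi Hneg) as [n [hn Hd]].
  apply IZR_le in Hd.
  destruct (upper_facts h q hh hq) as (U0 & U1 & Ua & Ub & Ur & US).
  destruct (lower_ends h q hh hq) as [La Lb].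
  destruct (rho_bounds q ltac:(lia)) as [Hr Hb].
  pose proof (lambda_bounds q ltac:(lia)) as hl.
  destruct (inv_hurwitz q ltac:(lia)) as [HG HG'].
  destruct (Theta_eq h q x n hh hq hx hi) as [W1 T1].
  destruct (back_nat_ext h q x n hh hq hx hi) as (_ & HI & _).
  pose proof (Hneg n hn) as Hn. pose proof (Hneg (S n) ltac:(lia)) as Hn'.
  pose proof (orbit_dom q x n ltac:(lra) hx hi) as hdom.
  destruct (rosen_map_spec q _ ltac:(lra) hdom ltac:(lra)) as (hr1 & hdom' & Et).
  change (rosen_map q (orbit q x n)) with (orbit q x (S n)) in *.
  pose proof (nat_ext_neg h q _ _ hh hq HI Hn) as HP.
  pose proof (nat_ext_neg1 h q _ _ hh hq HI) as HQ.
  pose proof (HT n ltac:(lia)) as H1. rewrite T1 in H1.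
  pose proof (hurwitz_pos q ltac:(lia)) as Hh.
  apply Rinv_lt_contravar in H1;
    [|apply Rmult_lt_0_compat; [assumption|apply Rinv_0_lt_compat; assumption]].
  rewrite Rinv_inv, HG, HG', Et in H1.
  unfold eps in H1. destruct (Rlt_dec (orbit q x n) 0); [|lra].
  unfold rosen_dom in hdom'.
  rewrite Rabs_left in Et by assumption.
  (* A digit of at least 3 would make 1 / Theta_n at least 3 lambda / 2 + rho, which exceeds 1 /
     H_q. *)
  destruct (IZR_ge_cases _ hr1) as [E|[E|E]]; [rewrite E in Hd; lra| |nra].
  rewrite E in *.
  (* From v_n <= lambda - rho follows -t_(n+1) > 2 lambda - 2 - rho, the cycle point [2 * h - 1].
     Beyond lambda - 1, t_n is left of -1 / (1 + lambda), and the sharper bound on v_n gives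
     -t_(n+1) > lambda - rho, the point [2 * h]. *)
  destruct (Rle_lt_dec (- orbit q x (S n)) (lambda q - 1)) as [Hs|Hs].
  - apply (orbit_not_trapped h q (2 * h - 1) (S n) x hh hq hx hi).
    + intros m hm. apply Hneg. lia.
    + split; [lia|]. replace (2 * h - 1 + 1)%nat with (2 * h)%nat by lia.
      rewrite Lb, Ua. lra.
  - apply (orbit_not_trapped h q (2 * h) (S n) x hh hq hx hi).
    + intros m hm. apply Hneg. lia.
    + split; [lia|]. rewrite La, Ub.
      assert (back q x n <= 2 * lambda q - 2 - rho q); [|lra].
      apply HQ. rewrite <- (Ropp_involutive (orbit q x n)).
      rewrite <- (Rinv_inv (- orbit q x n)), Et.
      apply Ropp_lt_contravar, Rinv_lt_contravar; nra.
Qed.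

(** * Optimality of the constant *)

Lemma rosen_map_lower (q k k' : nat) (r : Z) : 0 < lambda q < 2 ->
  0 < lower q k -> 0 < lower q k' <= lambda q / 2 ->
  / lower q k = IZR r * lambda q - lower q k' ->
  digit q (- lower q k) = r /\ rosen_map q (- lower q k) = - lower q k'.
Proof.
  intros hl Hp Hp' E.
  assert (Hr : digit q (- lower q k) = r).
  { unfold digit. rewrite Rabs_Ropp, Rabs_pos_eq by lra.
    symmetry. apply Int_part_spec.
    replace (1 / (lambda q * lower q k)) with (/ lower q k / lambda q) by (field; lra).
    rewrite E.
    replace ((IZR r * lambda q - lower q k') / lambda q)
      with (IZR r - lower q k' / lambda q) by (field; lra).
    assert (0 < lower q k' / lambda q) by (apply Rdiv_lt_0_compat; lra).
    assert (lower q k' / lambda q <= 1 / 2).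
    { apply (Rmult_le_reg_r (lambda q)); [lra|]. field_simplify; lra. }
    lra. }
  split; [assumption|].
  unfold rosen_map. destruct (Req_dec_T (- lower q k) 0); [lra|].
  rewrite Hr, Rabs_Ropp, Rabs_pos_eq by lra. lra.
Qed.

(* The digit-2 steps exchange [lower q 0] with [lower q (2 * h - 1)] and
   [lower q 1] with [lower q (2 * h)]; reading the periodic expansion backwards
   replaces [k] by [2 * h - k]. *)
Lemma lower_inv (h q k : nat) : (1 <= h)%nat -> q = (2 * h + 3)%nat -> (k <= 2 * h)%nat ->
  exists (r : Z) (k' : nat), (k' <= 2 * h)%nat /\
    / lower q k = IZR r * lambda q - lower q k' /\
    lower q (2 * h - k') = / (IZR r * lambda q - lower q (2 * h - k)) /\
    lambda q <= IZR r * lambda q /\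
    / lower q k - lower q (2 * h - k) <= / hurwitz q.
Proof.
  intros hh hq hk.
  destruct (lower_ends h q hh hq) as [La Lb].
  destruct (rho_bounds q ltac:(lia)) as [Hr Hb].
  pose proof (lambda_bounds q ltac:(lia)) as hl.
  destruct (inv_hurwitz q ltac:(lia)) as [-> HG'].
  (* For [k = 0] and [k = 1] the last inequality is an equality, which makes the point extremal;
     otherwise its left side is below lambda < 2 < 1 / H_q. *)
  destruct k as [|[|k]].
  - exists 2%Z, (2 * h - 1)%nat. replace (2 * h - (2 * h - 1))%nat with 1%nat by lia.
    rewrite Nat.sub_0_r, La, Lb. simpl lower. rewrite Rinv_inv.
    repeat split; [lia|ring|f_equal; ring|lra|lra].
  - exists 2%Z, (2 * h)%nat. rewrite Nat.sub_diag, La, Lb. simpl lower. rewrite Rinv_inv.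
    repeat split; [lia|ring|f_equal; ring|lra|lra].
  - exists 1%Z, k. change (lower q (S (S k))) with (/ (lambda q - lower q k)).
    replace (2 * h - k)%nat with (2 * h - S (S k) + 2)%nat by lia.
    rewrite lower_SS, Rinv_inv.
    pose proof (lower_bounds h q k hh hq ltac:(lia)).
    pose proof (lower_bounds h q (2 * h - S (S k)) hh hq ltac:(lia)).
    repeat split; [lia|ring|f_equal; ring|lra|lra].
Qed.

(** v_n starts at 0, below the periodic value w, and one step gives w' - v' = w' v' (w - v) with w'
    v' <= lambda - rho < 1. *)
Lemma orbit_lower (h q n : nat) : (1 <= h)%nat -> q = (2 * h + 3)%nat ->
  exists k, (k <= 2 * h)%nat /\ orbit q (rho q - lambda q) n = - lower q k /\
    lower q (2 * h - k) - (lambda q - rho q) ^ n <= back q (rho q - lambda q) n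
      <= lower q (2 * h - k).
Proof.
  intros hh hq.
  destruct (lower_ends h q hh hq) as [La Lb].
  destruct (rho_bounds q ltac:(lia)) as [Hr Hb].
  pose proof (lambda_bounds q ltac:(lia)) as hl.
  assert (Hle : forall k, (k <= 2 * h)%nat -> 0 < lower q k <= lambda q - rho q).
  { intros k hk. split; [apply (lower_bounds h); assumption|].
    rewrite <- La. apply (lower_incr h); try assumption. lia. }
  assert (Hmap : forall k, (k <= 2 * h)%nat -> exists (r : Z) (k' : nat), (k' <= 2 * h)%nat /\
    lower q (2 * h - k') = / (IZR r * lambda q - lower q (2 * h - k)) /\
    lambda q <= IZR r * lambda q /\
    digit q (- lower q k) = r /\ rosen_map q (- lower q k) = - lower q k').
  { intros k hk. destruct (lower_inv h q k hh hq hk) as (r & k' & hk' & E & E' & Hrl & _).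
    pose proof (Hle k hk). pose proof (Hle k' hk').
    exists r, k'. do 3 (split; [assumption|]). apply (rosen_map_lower q k k'); lra. }
  set (x := rho q - lambda q).
  assert (Horb : forall n, exists k, (k <= 2 * h)%nat /\ orbit q x n = - lower q k).
  { clear n. induction n as [|n [k [hk E]]].
    - exists (2 * h)%nat. split; [lia|]. rewrite La. unfold x, orbit. simpl. ring.
    - destruct (Hmap k hk) as (r & k' & hk' & _ & _ & _ & E').
      exists k'. split; [assumption|].
      change (orbit q x (S n)) with (rosen_map q (orbit q x n)). rewrite E. exact E'. }
  assert (hi : Gq_irrational q x).
  { intros [m Hm]. destruct (Horb m) as [k [hk E]]. pose proof (Hle k hk). lra. }
  assert (hx : rosen_dom q x) by (unfold rosen_dom, x; lra).
  induction n as [|n IH].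
  - exists (2 * h)%nat. split; [lia|]. split.
    + rewrite La. unfold x, orbit. simpl. ring.
    + rewrite Nat.sub_diag. unfold back. simpl pow. simpl rosen_rec. simpl fst. simpl snd.
      pose proof (Hle 0%nat ltac:(lia)). lra.
  - destruct IH as (k & hk & E & H1 & H2).
    destruct (Hmap k hk) as (r & k' & hk' & Ek' & Hrl & Er & E').
    exists k'. split; [assumption|]. split.
    { change (orbit q x (S n)) with (rosen_map q (orbit q x n)). rewrite E. exact E'. }
    destruct (back_nat_ext h q x n hh hq hx hi) as (_ & [Hv0 _] & ->).
    pose proof (Hle k hk) as Lk. pose proof (Hle k' hk').
    pose proof (Hle (2 * h - k)%nat ltac:(lia)) as Ls.
    pose proof (Hle (2 * h - k')%nat ltac:(lia)) as Ls'.
    rewrite E, Er. unfold eps. destruct (Rlt_dec (- lower q k) 0); [|lra].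
    set (v := back q x n) in *. set (w := lower q (2 * h - k)) in *.
    set (w' := lower q (2 * h - k')) in *. set (rl := IZR r * lambda q) in *.
    assert (Hv : / (rl + -1 * v) <= w').
    { rewrite Ek'. apply Rinv_le_contravar; lra. }
    assert (Hvp : 0 < / (rl + -1 * v)) by (apply Rinv_0_lt_compat; lra).
    split; [|assumption].
    assert (Ed : w' - / (rl + -1 * v) = w' * / (rl + -1 * v) * (w - v)).
    { rewrite Ek'. field. split; lra. }
    simpl pow.
    assert (w' * / (rl + -1 * v) <= lambda q - rho q) by nra.
    assert (w' * / (rl + -1 * v) * (w - v) <= (lambda q - rho q) * (lambda q - rho q) ^ n).
    { apply Rmult_le_compat; nra. }
    lra.
Qed.

Theorem theorem20 (h q : nat) (hh : (1 <= h)%nat) (hq : q = (2 * h + 3)%nat) :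
  (forall x : R, rosen_dom q x -> Gq_irrational q x ->
     infinitely_many (fun n => Theta q x n <= hurwitz q)) /\
  (forall C : R, C < hurwitz q ->
     ~ (forall x : R, rosen_dom q x -> Gq_irrational q x ->
          infinitely_many (fun n => Theta q x n <= C))).
Proof.
  split.
  { intros x hx hi. apply (Theta_le_hurwitz_infinitely h); assumption. }
  intros C HC Hall.
  destruct (rho_bounds q ltac:(lia)) as [Hr Hb].
  pose proof (lambda_bounds q ltac:(lia)) as hl.
  destruct (inv_hurwitz q ltac:(lia)) as [HG HG'].
  pose proof (hurwitz_pos q ltac:(lia)) as Hh.
  set (x := rho q - lambda q) in *.
  assert (hx : rosen_dom q x) by (unfold rosen_dom, x; lra).
  assert (hi : Gq_irrational q x).
  { intros [m Hm]. destruct (orbit_lower h q m hh hq) as (k & hk & E & _).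
    pose proof (lower_bounds h q k hh hq hk). fold x in E. lra. }
  (* 1 / Theta_n = 1 / |t_n| - v_n exceeds its periodic value, at most 1 / H_q, by no more than the
     error of v_n. *)
  assert (HT : forall n, 1 <= Theta q x n * (/ hurwitz q + (lambda q - rho q) ^ n)
    /\ 0 < Theta q x n).
  { intros n. destruct (Theta_eq h q x n hh hq hx hi) as [Hp ->].
    split; [|apply Rinv_0_lt_compat; assumption].
    destruct (orbit_lower h q n hh hq) as (k & hk & E & H1 & _). fold x in E, H1.
    destruct (lower_inv h q k hh hq hk) as (_ & _ & _ & _ & _ & _ & H2).
    pose proof (lower_bounds h q k hh hq hk).
    rewrite E, Rabs_Ropp, Rabs_pos_eq in * by lra. unfold eps in *.
    destruct (Rlt_dec (- lower q k) 0); [|lra].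
    set (W := / lower q k + -1 * back q x n) in *.
    apply (Rmult_le_reg_l W); [assumption|].
    rewrite <- Rmult_assoc, Rinv_r, Rmult_1_l, Rmult_1_r by lra. unfold W. lra. }
  assert (HC0 : 0 < C).
  { destruct (Hall x hx hi 0%nat) as (n & _ & Hn). pose proof (HT n). lra. }
  assert (HCh : C * / hurwitz q < 1).
  { apply (Rmult_lt_reg_r (hurwitz q)); [assumption|].
    rewrite Rmult_assoc, Rinv_l; lra. }
  (* This threshold makes C times (1 / H_q + (lambda - rho)^n) less than 1, against [HT] when
     Theta_n <= C. *)
  destruct (pow_lt_1_zero (lambda q - rho q) ltac:(rewrite Rabs_pos_eq; lra)
    ((1 - C * / hurwitz q) / C) ltac:(apply Rdiv_lt_0_compat; lra)) as [N HN].
  destruct (Hall x hx hi N) as (n & hn & Hn).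
  specialize (HN n hn). destruct (HT n) as [H1 H2].
  pose proof (Rle_abs ((lambda q - rho q) ^ n)) as Ha.
  assert (Hpn : 0 < (lambda q - rho q) ^ n) by (apply pow_lt; lra).
  assert (H3 : C * (lambda q - rho q) ^ n < 1 - C * / hurwitz q).
  { replace (1 - C * / hurwitz q) with (C * ((1 - C * / hurwitz q) / C)) by (field; lra).
    apply Rmult_lt_compat_l; lra. }
  assert (0 < / hurwitz q) by (apply Rinv_0_lt_compat; assumption).
  assert (Theta q x n * (/ hurwitz q + (lambda q - rho q) ^ n)
    <= C * (/ hurwitz q + (lambda q - rho q) ^ n)) by (apply Rmult_le_compat_r; lra).
  lra.
Qed.
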